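(* The following hold. (i) $\{z^{-n}: n\in\mathbb{Z},\ n\ge0\}$ is a basis for $L^2(\mathcal{Z},\mathcal{M},\mu)$. (ii) The Gram–Schmidt process applied in $L^2(\mathcal{Z},\mathcal{M},\mu)$ to the sequence $z^0,z^{-1},z^{-2},\dots$ yields the sequence $g_0,g_2,g_4,\dots$. (iii) For each integer $n\ge0$, $\mathrm{span}\{z^{-k}:0\le k\le n\}=\mathrm{span}\{g_{2k}:0\le k\le n\}$.
   Context: $\mathcal{Z}=[\frac14,+\infty)$; $\mathcal{M}$ is the $\sigma$-field of all Lebesgue measurable subsets of $\mathcal{Z}$; $\mu$ is the measure on $(\mathcal{Z},\mathcal{M})$ given by $\mu(E)=\int_E\frac{\sqrt{4z-1}}{2\pi z^2}\,dz$. $L^2(\mathcal{Z},\mathcal{M},\mu)$ is the space of real-valued $\mu$-measurable functions $f$ on $\mathcal{Z}$ (identified when equal $\mu$-a.e.) with $\int_{\mathcal{Z}}|f|^2\,d\mu<\infty$, with inner product $(f,g)=\int_{\mathcal{Z}}fg\,d\mu$ and norm $\|f\|_2=(f,f)^{1/2}$. For each integer $n\ge0$, $g_{2n}(z)=\sum_{k=0}^{n}(-1)^k\binom{2n-k}{k}z^{k-n}$. ''Basis'' is used in the following sense: a collection $\mathcal{F}\subset L^2(\mathcal{Z},\mathcal{M},\mu)$ is a basis if for each $f\in L^2(\mathcal{Z},\mathcal{M},\mu)$ and each $\epsilon>0$ there exist finitely many elements $f_0,\dots,f_N\in\mathcal{F}$ and real numbers $c_0,\dots,c_N$ with $\|f-\sum_{k=0}^N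 c_kf_k\|_2<\epsilon$. The Gram–Schmidt process applied to $w_0,w_1,\dots$ produces $v_0=w_0$ and $v_n=w_n-\sum_{k=0}^{n-1}\frac{(w_n,v_k)}{(v_k,v_k)}v_k$ for $n\ge1$; the claim in (ii) is that $v_n=g_{2n}$ for all $n\ge0$ when $w_n=z^{-n}$. *)

(* Defs.v *)
From HB Require Import structures.
From mathcomp Require Import all_boot all_order all_algebra.
From mathcomp Require Import all_classical all_reals all_analysis.
From mathcomp Require Import measurable_realfun.
Import Order.TTheory GRing.Theory Num.Theory.
Import numFieldNormedType.Exports.

Set Implicit Arguments.
Unset Strict Implicit.
Unset Printing Implicit Defensive.

Local Open Scope classical_set_scope.
Local Open Scope ring_scope.

Section Zspace.
Context (R : realType).

(* R with the sigma-algebra of Lebesgue (not only Borel) measurable sets, i.e.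
   the domain of [completed_lebesgue_measure]. *)
Definition leb : measurableType _ :=
  caratheodory_type (@mu_ext _ _ R (@wlength R idfun)).

Definition Zset : set R := `[4^-1, +oo[.

Definition Zcarrier : Type := set_type Zset.

Lemma Zset_quarter : 4^-1 \in Zset.
Proof. by rewrite inE /Zset /= in_itv /= lexx. Qed.

HB.instance Definition _ := Choice.on Zcarrier.
HB.instance Definition _ :=
  isPointed.Build Zcarrier (exist _ 4^-1 Zset_quarter).

Definition Zval (z : Zcarrier) : leb := val z.

(* The trace sigma-algebra; see [measurable_ZE]. *)
Definition Z : measurableType _ := g_sigma_algebra_preimageType Zval.

Lemma sub_leb (A : set R) : measurable A -> measurable (A : set leb).
Proof. exact: sub_caratheodory. Qed.

Lemma measurable_ZE (A : set Z) :
  measurable A <-> measurable (Zval @` A : set leb).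
Proof.
split=> [[B mB <-]|mA]; last first.
  exists (Zval @` A) => //; rewrite setTI; apply/seteqP; split => [z|z Az].
    by case=> y Ay /val_inj <-.
  by exists z.
have -> : Zval @` (setT `&` Zval @^-1` B) = B `&` (Zset : set leb).
  apply/seteqP; split => [_ [z [_ Bz] <-]|x [Bx Zx]].
    by split => //; exact: set_valP z.
  have Zx' : x \in Zset by rewrite inE.
  by exists (exist _ x Zx').
by apply: measurableI => //; apply: sub_leb; exact: measurable_itv.
Qed.

Definition density (z : R) : R := Num.sqrt (4 * z - 1) / (2 * pi * z ^+ 2).

Lemma density_ge0 z : 0 <= density z.
Proof.
by rewrite divr_ge0 ?sqrtr_ge0 // mulr_ge0 ?sqr_ge0 // mulr_ge0 ?pi_ge0.
Qed.

Lemma measurable_inv : measurable_fun [set: R] (@GRing.inv R).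
Proof.
rewrite -(setUv [set 0]); apply/measurable_funU => //.
  exact: measurableC.
split; first exact: measurable_fun_set1.
apply: open_continuous_measurable_fun.
  exact/closed_openC/accessible_closed_set1/hausdorff_accessible/Rhausdorff.
by move=> x; rewrite inE /= => /eqP x0; exact: inv_continuous.
Qed.

Lemma measurable_density : measurable_fun [set: leb] density.
Proof.
suff mf : measurable_fun [set: R] density.
  move=> _ B mB; apply: sub_leb; exact: (mf measurableT B mB).
apply: measurable_funM.
  apply: (measurableT_comp (f := @Num.sqrt R)).
    exact: (continuous_measurable_fun (@sqrt_continuous R)).
  by apply: measurable_funB => //; exact: measurable_funM.
apply: (measurableT_comp (f := @GRing.inv R)); first exact: measurable_inv.
by apply: measurable_funM => //; exact: measurable_funX.
Qed.

Definition mu (E : set Z) : \bar R :=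
  (\int[completed_lebesgue_measure]_(z in Zval @` E) (density z)%:E)%E.

Let mu0 : mu set0 = 0%E.
Proof. by rewrite /mu image_set0 integral_set0. Qed.

Let mu_ge0 E : (0 <= mu E)%E.
Proof. by apply: integral_ge0 => z _; rewrite lee_fin density_ge0. Qed.

Let mu_sigma_additive : semi_sigma_additive mu.
Proof.
move=> A mA tA mUA; rewrite /mu image_bigcup ge0_integral_bigcup //.
- apply: is_cvg_ereal_nneg_natsum_cond => n _ _.
  by apply: integral_ge0 => z _; rewrite lee_fin density_ge0.
- by move=> k; apply/measurable_ZE.
- apply/measurable_EFinP; apply: measurable_funTS; exact: measurable_density.
- by move=> x _; rewrite lee_fin density_ge0.
- move=> i j _ _ [x [[a Aa <-] [b Ab /val_inj ba]]].
  by apply: tA => //; exists a; split => //; rewrite -ba.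
Qed.

HB.instance Definition _ :=
  isMeasure.Build _ _ _ mu mu0 mu_ge0 mu_sigma_additive.

End Zspace.

Section L2.
Context (R : realType).
Local Notation Z := (Z R).
Local Notation mu := (@mu R).

(* Elements of L^2 are handled through representatives f : Z -> R; equality of
   representatives is pointwise and implies equality mu-a.e. *)
Definition L2 : set (Z -> R) := [set f | f \in Lfun mu 2%:E].

Definition inner (f g : Z -> R) : R := \int[mu]_z (f z * g z).

Definition norm2 (f : Z -> R) : R := Num.sqrt (inner f f).

Definition L2_basis (F : set (Z -> R)) : Prop :=
  F `<=` L2 /\
  forall f, L2 f -> forall e : R, 0 < e ->
    exists (N : nat) (h : 'I_N.+1 -> Z -> R) (c : 'I_N.+1 -> R),
      (forall k, F (h k)) /\
      norm2 (fun z => f z - \sum_(k < N.+1) c k * h k z) < e.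

Definition gs_step (u : Z -> R) (s : seq (Z -> R)) : Z -> R :=
  fun z => u z - \sum_(v <- s) inner u v / inner v v * v z.

(* [gs_prefix w n] is [:: v_0; ...; v_(n-1)]. *)
Fixpoint gs_prefix (w : nat -> Z -> R) (n : nat) : seq (Z -> R) :=
  if n is m.+1 then rcons (gs_prefix w m) (gs_step (w m) (gs_prefix w m))
  else [::].

Definition gram_schmidt (w : nat -> Z -> R) (n : nat) : Z -> R :=
  gs_step (w n) (gs_prefix w n).

Lemma gram_schmidtE w n z :
  gram_schmidt w n z = w n z - \sum_(k < n)
    inner (w n) (gram_schmidt w k) / inner (gram_schmidt w k) (gram_schmidt w k)
      * gram_schmidt w k z.
Proof.
have E m : gs_prefix w m = [seq gram_schmidt w k | k <- iota 0 m].
  elim: m => [//|m IH].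
  by rewrite -[in RHS]addn1 iotaD map_cat /= -IH cats1 add0n.
rewrite {1}/gram_schmidt /gs_step E big_map.
by have -> : iota 0 n = index_iota 0 n; rewrite ?big_mkord // /index_iota subn0.
Qed.

(* span {w_0, ..., w_n} *)
Definition span_upto (w : nat -> Z -> R) (n : nat) : set (Z -> R) :=
  [set f | exists c : 'I_n.+1 -> R,
     f = fun z => \sum_(k < n.+1) c k * w k z].

Definition zpow (n : nat) : Z -> R := fun z => Zval z ^ (- n%:Z).

(* [g_even n] is g_{2n}. *)
Definition g_even (n : nat) : Z -> R := fun z =>
  \sum_(k < n.+1) (-1) ^+ k * 'C(2 * n - k, k)%:R * Zval z ^ (k%:Z - n%:Z).

End L2.

(* Main.v *)
(** Put z = 1 / (4 cos^2 t) with 0 <= t < pi/2.  Then mu becomes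
    (4 / pi) sin^2 t dt and g_{2n}(z) sin t = sin ((2n+1) t), so the g_{2n} are
    orthonormal.  As g_{2n} is a monic polynomial of degree n in 1/z, it is what
    Gram-Schmidt produces from the powers of 1/z, and the spans agree.

    For the density of the polynomials in x = 1/z, which ranges over ]0, 4]: if q
    is affine in x with values in [0, 1], the polynomials (1 - q^n)^(n 2^n) are
    bounded by 1 and converge pointwise to the indicator of {q < 1/2}.  Hence
    indicators of rays are limits of polynomials in L^2; Dynkin's theorem extends
    this to Borel sets, a null set correction to Lebesgue measurable sets, and
    dominated convergence to simple functions and all of L^2. *)
From HB Require Import structures.
Require Import Defs.
From mathcomp Require Import all_boot all_order all_algebra.
From mathcomp Require Import all_classical all_reals all_analysis.
From mathcomp Require Import measurable_realfun.
From mathcomp Require Import ring lra zify.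
Import Order.TTheory GRing.Theory Num.Theory.
Import numFieldNormedType.Exports.

Set Implicit Arguments.
Unset Strict Implicit.
Unset Printing Implicit Defensive.

Local Open Scope classical_set_scope.
Local Open Scope ring_scope.

(** * The integral with respect to [mu] *)

Section MeasureWithDensity.
Context d (T : measurableType d) (R : realType).
Variables (m nu : {measure set T -> \bar R}) (w : T -> R).
Hypothesis mw : measurable_fun setT w.
Hypothesis w_ge0 : forall x, 0 <= w x.
Hypothesis nuE : forall A, measurable A -> nu A = (\int[m]_(x in A) (w x)%:E)%E.
Local Open Scope ereal_scope.
Import HBNNSimple.

(** Linearity over the level sets of [h] reduces this to indicators, where it is [nuE]. *)
Let nnsfun_density (h : {nnsfun T >-> R}) :
  \int[nu]_x (h x)%:E = \int[m]_x (h x * w x)%:E.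
Proof.
transitivity (\int[nu]_x
   (\sum_(y \in range h) (y * \1_(h @^-1` [set y]) x)%:E)).
  by apply: eq_integral => t _; rewrite /= fimfunE -fsumEFin.
transitivity (\int[m]_x (\sum_(y \in range h)
    (y * \1_(h @^-1` [set y]) x)%:E * (w x)%:E)); last first.
  apply: eq_integral => x _.
  rewrite -ge0_mule_fsuml => [|y]; last exact: nnfun_muleindic_ge0.
  by rewrite fsumEFin // -(fimfunE _ x).
have mh y : measurable_fun setT (fun x => (y * \1_(h @^-1` [set y]) x)%:E).
  by apply/measurable_EFinP; exact: measurable_funM.
rewrite !ge0_integral_fsum//; first last.
- by move=> n x _; exact: nnfun_muleindic_ge0.
- by move=> n x _; rewrite mule_ge0 ?nnfun_muleindic_ge0// lee_fin.
- by move=> y; apply: emeasurable_funM => //; exact/measurable_EFinP.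
apply: eq_fsbigr => r _.
rewrite integralZl_indic_nnsfun //.
under [RHS]eq_integral do rewrite EFinM -muleA.
have mi : measurable_fun setT (fun x => (\1_(h @^-1` [set r]) x)%:E * (w x)%:E).
  by apply: emeasurable_funM; exact/measurable_EFinP.
(* A negative [r] is not a value of [h]: its level set is empty and both sides vanish. *)
have [r0|r0] := leP 0%R r.
  rewrite ge0_integralZl//; last by move=> x _; rewrite mule_ge0// lee_fin.
  congr (_ * _); rewrite integral_indic// setIT nuE// integral_mkcond.
  apply: eq_integral => x _; rewrite /patch indicE.
  by case: ifPn => _; rewrite ?mul1e ?mul0e.
have -> : h @^-1` [set r] = set0 by exact: preimage_nnfun0.
rewrite indic0 integral0_eq ?mule0; last by move=> x _; rewrite /cst.
by rewrite integral0_eq// => x _; rewrite /cst mul0e mule0.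
Qed.

(** Monotone convergence along simple functions increasing to [f], used on both sides, extends
    [nnsfun_density]. *)
Lemma ge0_integral_density (f : T -> R) :
  measurable_fun setT f -> (forall x, (0 <= f x)%R) ->
  \int[nu]_x (f x)%:E = \int[m]_x (f x * w x)%:E.
Proof.
move=> mf f0; have mEf : measurable_fun setT (EFin \o f) by exact/measurable_EFinP.
pose h := nnsfun_approx measurableT mEf.
have hf x : (h n x)%:E @[n --> \oo] --> (f x)%:E.
  by apply: (@cvg_nnsfun_approx _ _ _ _ measurableT _ mEf) => // y _; rewrite lee_fin.
have ndh x : {homo (fun n => h n x) : a b / (a <= b)%N >-> (a <= b)%R}.
  by move=> a b ab; exact/lefP/nd_nnsfun_approx.
transitivity (limn (fun n => \int[nu]_x (h n x)%:E)).
  rewrite -monotone_convergence//.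
  - by apply: eq_integral => x _; apply/esym/cvg_lim.
  - by move=> n; exact/measurable_EFinP.
  - by move=> n x _; rewrite lee_fin.
  - by move=> x _ a b ab; rewrite lee_fin ndh.
under eq_fun do rewrite nnsfun_density.
rewrite -monotone_convergence//.
- apply: eq_integral => x _; apply/cvg_lim => //=; rewrite EFinM.
  by under eq_fun do rewrite EFinM; apply: cvgeZr.
- by move=> n; apply/measurable_EFinP; exact: measurable_funM.
- by move=> n x _; rewrite lee_fin mulr_ge0.
- by move=> x _ a b ab; rewrite lee_fin ler_wpM2r// ndh.
Qed.

End MeasureWithDensity.

(** * Integrals over [Z] as Lebesgue integrals over a half-line *)

Section Zmeasure.
Context (R : realType).
Local Notation Z := (Z R).
Local Notation mu := (@mu R).
Local Notation leb := (leb R).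

Lemma measurable_Zval_leb : measurable_fun [set: Z] (@Zval R : Z -> leb).
Proof. by move=> _ B mB; exists B. Qed.

Lemma measurable_id_leb :
  measurable_fun [set: leb] (id : leb -> measurableTypeR R).
Proof. by move=> _ B mB; rewrite setTI; exact: sub_leb. Qed.

Lemma measurable_Zval : measurable_fun [set: Z] (@Zval R : Z -> R).
Proof.
exact: (measurableT_comp (f := (id : leb -> measurableTypeR R))
  measurable_id_leb measurable_Zval_leb).
Qed.

(** The identity from Lebesgue to Borel sets pushes the completed measure forward to
    [lebesgue_measure]. *)
Lemma ge0_integral_completed (f : R -> \bar R) (D : set R) :
  measurable D -> measurable_fun D f -> (forall x, 0 <= f x)%E ->
  (\int[completed_lebesgue_measure]_(x in D) f x =
   \int[lebesgue_measure]_(x in D) f x)%E.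
Proof.
move=> mD mf f0.
have H := @ge0_integral_pushforward _ _ leb (measurableTypeR R) R id
  measurable_id_leb completed_lebesgue_measure D f mD mf (fun x _ => f0 x).
rewrite preimage_id in H; rewrite /= in H; rewrite -[LHS]H.
by apply: eq_measure_integral => //; exact: measurable_id_leb.
Qed.

Lemma measurable_density_Borel : measurable_fun [set: R] (@density R).
Proof.
apply: measurable_funM.
  apply: (measurableT_comp (f := @Num.sqrt R)).
    exact: (continuous_measurable_fun (@sqrt_continuous R)).
  by apply: measurable_funB => //; exact: measurable_funM.
apply: (measurableT_comp (f := @GRing.inv R)); first exact: Defs.measurable_inv.
by apply: measurable_funM => //; exact: measurable_funX.
Qed.

Lemma image_Zval_preimage (A : set R) : @Zval R @` (@Zval R @^-1` A) = A `&` @Zset R.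
Proof.
apply/seteqP; split => [_ [z Az <-]|x [Ax Zx]]; first by split; [|exact: set_valP z].
have Zx' : x \in @Zset R by rewrite inE.
by exists (exist _ x Zx').
Qed.

(** The image of [mu] under [Zval] has density [w] for the completed measure; as the integrand is
    Borel, the completion can then be dropped. This gives access to the fundamental theorem of
    calculus. *)
Lemma ge0_integral_mu (f : R -> R) :
  measurable_fun setT f -> (forall x, 0 <= f x) ->
  (\int[mu]_z (f (Zval z))%:E =
   \int[lebesgue_measure]_(x in `[4^-1%R, +oo[) (f x * density x)%:E)%E.
Proof.
move=> mf f0.
pose w : R -> R := (@density R) \_ (@Zset R).
have mZ : measurable (@Zset R : set (measurableTypeR R)) by exact: measurable_itv.
have mw : measurable_fun [set: leb] w.
  apply/(measurable_restrictT _ _).1; first exact: sub_leb.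
  exact: measurable_funTS (@measurable_density R).
have w0 x : 0 <= w x by rewrite /w /patch; case: ifP => // _; exact: density_ge0.
have mf' : measurable_fun [set: leb] f.
  exact: (measurableT_comp (f := f : measurableTypeR R -> R) mf measurable_id_leb).
have nuE A : measurable (A : set leb) ->
    (pushforward mu (@Zval R : Z -> leb) A =
     \int[completed_lebesgue_measure]_(x in A) (w x)%:E)%E.
  move=> mA; rewrite /pushforward /mu image_Zval_preimage integral_mkcondr.
  by apply: eq_integral => x _; rewrite /w /patch; case: ifP.
have mEf : measurable_fun [set: leb] (EFin \o f) by exact/measurable_EFinP.
have H := @ge0_integral_pushforward _ _ Z leb R _ measurable_Zval_leb mu setT
  (EFin \o f) measurableT mEf (fun x _ => f0 x).
rewrite preimage_setT in H; rewrite -[LHS]H.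
rewrite (ge0_integral_density mw w0 nuE mf' f0).
rewrite [RHS](_ : _ = \int[lebesgue_measure]_(x in setT) (f x * w x)%:E)%E; last first.
  rewrite integral_mkcond; apply: eq_integral => x _; rewrite /w /patch.
  by case: ifP; rewrite ?mulr0.
apply: ge0_integral_completed => //; last by move=> x; rewrite lee_fin mulr_ge0.
apply/measurable_EFinP; apply: measurable_funM => //.
apply/(measurable_restrictT _ _).1 => //; apply: measurable_funTS.
exact: measurable_density_Borel.
exact: measurable_Zval_leb.
Qed.

End Zmeasure.

(** * Orthonormality *)

Section ChebyshevPolynomials.
Context {R : realType}.

(* The polynomial in [1/z] that equals g_{2n}; see [g_evenE]. *)
Definition gpoly (n : nat) : {poly R} :=
  \sum_(k < n.+1) ((-1) ^+ k * 'C(2 * n - k, k)%:R) *: 'X^(n - k).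

(** Only the summand k = n - i contributes to 'X^i, and there 2n - k = n + i. In particular
    [gpoly n] is monic of degree n. *)
Lemma coef_gpoly n i :
  (gpoly n)`_i = if (i <= n)%N then (-1) ^+ (n - i) * 'C(n + i, n - i)%:R else 0.
Proof.
rewrite coef_sum; case: leqP => [le_in|lt_ni]; last first.
  rewrite big1// => k _; rewrite coefZ coefXn.
  by case: eqP => [E|_]; rewrite ?mulr0//; move: lt_ni; rewrite E; lia.
have lt_nin : (n - i < n.+1)%N by lia.
rewrite (bigD1 (Ordinal lt_nin))//= big1 ?addr0 => [|k].
  rewrite coefZ coefXn subKn// eqxx mulr1; congr (_ * 'C(_, _)%:R); lia.
rewrite -val_eqE/= => nk; rewrite coefZ coefXn.
case: eqP => [E|_]; rewrite ?mulr0//.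
by move: nk; rewrite E subKn ?eqxx// -ltnS.
Qed.

(** At 4 cos^2 t the factor 'X - 2 is 2 cos 2t, so this mirrors sin((2n+5)t) + sin((2n+1)t) = 2 cos
    2t sin((2n+3)t). The proof compares coefficients. *)
Lemma gpolySS n : gpoly n.+2 = ('X - 2%:P) * gpoly n.+1 - gpoly n.
Proof.
apply/polyP => i; rewrite coefB mulrBl coefB mul_polyC coefZ coefXM !coef_gpoly.
case: i => [|j] /=.
  by rewrite !subn0 !addn0 !binn !exprS; ring.
(* The index is i = j + 1. Only for j < n are all coefficients involved within the degrees of their
   polynomials. *)
have [->|->|[m ->]|lt_nj] : [\/ j = n.+1, j = n, exists m, n = (j + m).+1 | (n.+1 < j)%N].
- case: (ltngtP j n.+1) => [|lt_nj|->]; [|by constructor 4|by constructor 1].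
  rewrite ltnS leq_eqVlt => /predU1P[->|lt_jn]; [by constructor 2|constructor 3].
  by exists (n - j.+1)%N; lia.
- rewrite !ltnn !ltnS leqnn ltnNge leqnSn /= !subnn !bin0; ring.
- rewrite ltnn !ltnS leqnn leqnSn !subSS subnn subSnn !bin0 !bin1.
  rewrite -!natr1 !natrD -!natr1; ring.
- have -> : ((j < (j + m).+3) = true)%N by lia.
  have -> : ((j <= (j + m).+2) = true)%N by lia.
  have -> : ((j < (j + m).+2) = true)%N by lia.
  have -> : ((j < (j + m).+1) = true)%N by lia.
  have -> : ((j + m).+3 - j.+1 = m.+2)%N by lia.
  have -> : ((j + m).+2 - j = m.+2)%N by lia.
  have -> : ((j + m).+2 - j.+1 = m.+1)%N by lia.
  have -> : ((j + m).+1 - j.+1 = m)%N by lia.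
  rewrite !addnS !addSn; move: (j + m + j)%N => N.
  (* The recurrence for this coefficient once the common sign is removed, with N = 2j + m. *)
  have pascal : ('C(N.+4, m.+2) + 'C(N.+2, m) = 'C(N.+2, m.+2) + 2 * 'C(N.+3, m.+1))%N.
    by rewrite !binS; lia.
  have {}pascal : 'C(N.+4, m.+2)%:R =
      'C(N.+2, m.+2)%:R + 2 * 'C(N.+3, m.+1)%:R - 'C(N.+2, m)%:R :> R.
    by apply/eqP; rewrite eq_sym subr_eq -natrM -!natrD -pascal.
  by rewrite pascal !exprS; ring.
- have -> : (j < n.+2 = false)%N by lia.
  have -> : (j <= n.+1 = false)%N by lia.
  have -> : (j < n.+1 = false)%N by lia.
  have -> : (j < n = false)%N by lia.
  by rewrite !mulr0 !subr0.
Qed.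

Lemma gpoly0 : gpoly 0 = 1.
Proof. by rewrite /gpoly big_ord1 /= expr0 mul1r bin0 scale1r. Qed.

Lemma gpoly1 : gpoly 1 = 'X - 1.
Proof.
by rewrite /gpoly !big_ord_recr big_ord0 /= add0r expr0 bin0 mul1r mulr1
  subn0 !expr1 expr0 scale1r scaleN1r.
Qed.

(** Thus [gpoly n] at 4 x^2 is the Chebyshev polynomial of the second kind U_{2n}(x). In the
    induction, (2n+5)t and (2n+1)t are written as (2n+3)t plus and minus 2t. *)
Lemma horner_gpoly_cos n (t : R) :
  (gpoly n).[4 * cos t ^+ 2] * sin t = sin ((2 * n + 1)%:R * t).
Proof.
pose P n := (gpoly n).[4 * cos t ^+ 2] * sin t = sin ((2 * n + 1)%:R * t).
suff: P n /\ P n.+1 by case.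
have cs : sin t ^+ 2 = 1 - cos t ^+ 2 by rewrite -(cos2Dsin2 t) addrC addKr.
elim: n => [|n [IH IH1]]; split.
- by rewrite /P gpoly0 hornerC !mul1r.
- rewrite /P gpoly1 !hornerE /= (_ : _%:R * t = t + t + t); last by ring.
  rewrite !(sinD, cosD).
  rewrite (_ : _ - 1 = 3 * cos t ^+ 2 - sin t ^+ 2); last by rewrite cs; ring.
  by ring.
- exact: IH1.
- rewrite /P gpolySS hornerD hornerN hornerM hornerXsubC mulrBl -mulrA IH IH1.
  rewrite (_ : (2 * n.+2 + 1)%:R * t = (2 * n.+1 + 1)%:R * t + (t + t)); last first.
   by rewrite !mulnS !natrD; ring.
  rewrite (_ : (2 * n + 1)%:R * t = (2 * n.+1 + 1)%:R * t - (t + t)); last first.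
   by rewrite !mulnS !natrD; ring.
  rewrite sinB (sinD _ (t + t)) (cosD t t) -!expr2 cs; ring.
Qed.

End ChebyshevPolynomials.

(** * The substitution z = 1 / (4 cos^2 t) and the resulting integrals *)

Section Orthonormality.
Context {R : realType}.

(** The antiderivative of cos(c x) vanishing at 0. The case c = 0 arises from the difference of two
    equal frequencies. *)
Definition sin_prim (c x : R) : R := if c == 0 then x else sin (c * x) / c.

Lemma is_derive_sin_prim c (x : R) : is_derive x 1 (sin_prim c) (cos (c * x)).
Proof.
rewrite /sin_prim; have [->|c0] := eqVneq c 0.
  by rewrite mul0r cos0; exact: is_derive_id.
have -> : (fun x => sin (c * x) / c) = (sin \o (cst c * id)) * cst c^-1 by [].
apply: is_derive_eq.
by rewrite /= /GRing.scale /= !fctE; field.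
Qed.

(** An antiderivative of 2 (sin(a x) + sin(b x))^2, expanded into cosines of frequencies 2a, 2b, a -
    b and a + b. Doublings are written as sums so that the sum rules for derivatives suffice. *)
Definition sin2_prim (a b : R) : R -> R :=
  (id + id - sin_prim (2 * a) - sin_prim (2 * b)) +
  ((sin_prim (a - b) - sin_prim (a + b)) + (sin_prim (a - b) - sin_prim (a + b))).

Lemma is_derive_sin2_prim a b (x : R) :
  is_derive x 1 (sin2_prim a b) (2 * (sin (a * x) + sin (b * x)) ^+ 2).
Proof.
have D c : is_derive x 1 (sin_prim c) (cos (c * x)) by exact: is_derive_sin_prim.
have DB := is_deriveB (D (a - b)) (D (a + b)).
have DI := is_deriveD (is_derive_id x 1) (is_derive_id x 1).
apply: (is_derive_eq
  (is_deriveD (is_deriveB (is_deriveB DI (D (2 * a))) (D (2 * b))) (is_deriveD DB DB))).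
rewrite [(a - b) * x]mulrBl [(a + b) * x]mulrDl cosB cosD.
rewrite -[2 * a * x]mulrA -[2 * b * x]mulrA !mulr_natl !cos_mulr2n !cos2sin2.
by ring.
Qed.

(* The [t] in [0, pi/2[ with [z = 1 / (4 cos^2 t)]; see [sqr_cos_angle]. *)
Definition angle (z : R) : R := atan (Num.sqrt (4 * z - 1)).

Lemma is_derive_angle (z : R) : 4^-1 < z ->
  is_derive z 1 angle (2 * z * Num.sqrt (4 * z - 1))^-1.
Proof.
move=> z4; have z0 : 0 < 4 * z - 1 by lra.
have -> : angle = atan \o (Num.sqrt \o (cst 4 * id - cst 1)) by [].
have ? := is_derive1_sqrt z0.
apply: is_derive_eq.
rewrite /= /GRing.scale /= !fctE sqr_sqrtr ?ltW//.
have s0 : Num.sqrt (4 * z - 1) != 0 by rewrite gt_eqF// sqrtr_gt0.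
have zN0 : z != 0 by apply: lt0r_neq0; lra.
by field; rewrite s0 zN0 /=; apply: lt0r_neq0; lra.
Qed.

Lemma continuous_angle (z : R) : {for z, continuous angle}.
Proof.
rewrite (_ : angle = atan \o (Num.sqrt \o (fun z => 4 * z - 1)))//.
apply: continuous_comp; last exact: continuous_atan.
apply: continuous_comp; last exact: sqrt_continuous.
by apply: cvgB; [apply: cvgM; [exact: cvg_cst|exact: cvg_id]|exact: cvg_cst].
Qed.

Lemma sqr_cos_angle (z : R) : 4^-1 <= z -> 4 * cos (angle z) ^+ 2 = z^-1.
Proof.
move=> z4; have z0 : z != 0 by apply: lt0r_neq0; lra.
have s2 : Num.sqrt (4 * z - 1) ^+ 2 = 4 * z - 1 by rewrite sqr_sqrtr//; lra.
rewrite /angle cos_atan exprVn s2 sqr_sqrtr; last by lra.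
by field; rewrite z0 /= (_ : 1 + (4 * z - 1) = 4 * z) ?mulf_neq0//; ring.
Qed.

Lemma sqr_sin_angle (z : R) : 4^-1 <= z -> sin (angle z) ^+ 2 = (4 * z - 1) / (4 * z).
Proof.
move=> z4; have z0 : z != 0 by apply: lt0r_neq0; lra.
rewrite sin2cos2; have := sqr_cos_angle z4.
set c := cos _ => E; have -> : c ^+ 2 = z^-1 / 4 by rewrite -E; field.
by field.
Qed.

(** The integrand of the squared L^2 norm of p(1/z). *)
Definition dens2 (p : {poly R}) (z : R) : R := p.[z^-1] ^+ 2 * density z.

(* The right-hand side is [2 / pi] times the derivative of [sin2_prim _ _ \o angle]. *)
Lemma dens2E n m (z : R) : 4^-1 < z ->
  dens2 (gpoly n + gpoly m) z =
  2 / pi * (2 * (sin ((2 * n + 1)%:R * angle z) + sin ((2 * m + 1)%:R * angle z)) ^+ 2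
    / (2 * z * Num.sqrt (4 * z - 1))).
Proof.
move=> z4; rewrite -!horner_gpoly_cos sqr_cos_angle ?ltW// -mulrDl -hornerD.
rewrite exprMn sqr_sin_angle ?ltW// /dens2 /density.
have z0 : 0 < 4 * z - 1 by lra.
have s0 : Num.sqrt (4 * z - 1) != 0 by rewrite gt_eqF// sqrtr_gt0.
move: (sqr_sqrtr (ltW z0)) s0; set s := Num.sqrt _ => <- s0.
have pi0 : pi != 0 :> R by rewrite gt_eqF ?pi_gt0.
have zN0 : z != 0 by apply: lt0r_neq0; lra.
by move: pi pi0 => q q0; field; rewrite s0 zN0.
Qed.

Lemma sin_natr_pi n : sin (n%:R * pi) = 0 :> R.
Proof.
elim: n => [|n IH]; first by rewrite mul0r sin0.
by rewrite -natr1 mulrDl mul1r sinDpi IH oppr0.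
Qed.

(** All frequencies are even, so at pi / 2 the sines vanish. What remains is the linear term, plus
    the contribution of a - b when it is zero. *)
Lemma sin2_prim_pihalf n m :
  sin2_prim (2 * n + 1)%:R (2 * m + 1)%:R (pi / 2) = pi * (1 + (n == m)%:R).
Proof.
have S0 k : sin_prim k.+1.*2%:R (pi / 2) = 0.
  rewrite /sin_prim pnatr_eq0 /= -mul2n natrM.
  rewrite [_ * _ * _](_ : _ = k.+1%:R * pi); last by field.
  by rewrite sin_natr_pi mul0r.
have odd2 k : 2 * (2 * k + 1)%:R = (2 * k).+1.*2%:R :> R.
  by rewrite -natrM; congr _%:R; lia.
have Sdiff : sin_prim ((2 * n + 1)%:R - (2 * m + 1)%:R) (pi / 2) = pi / 2 *+ (n == m).
  rewrite /sin_prim subr_eq0 eqr_nat eqn_add2r eqn_pmul2l//.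
  case: eqP => [//|_]; rewrite [X in sin X](_ : _ = n%:R * pi - m%:R * pi).
    by rewrite sinB !sin_natr_pi mul0r mulr0 subr0 mul0r.
  by field.
have Ssum : sin_prim ((2 * n + 1)%:R + (2 * m + 1)%:R) (pi / 2) = 0.
  by rewrite -natrD -(S0 (n + m)%N); congr (sin_prim _%:R _); lia.
rewrite /sin2_prim !fctE /= !odd2 !S0 Sdiff Ssum.
by case: (n == m); rewrite ?mulr1n ?mulr0n; field.
Qed.

Lemma sin2_prim0 a b : sin2_prim a b 0 = 0.
Proof.
have S0 c : sin_prim c 0 = 0.
  by rewrite /sin_prim mulr0 sin0 mul0r; case: ifP.
by rewrite /sin2_prim !fctE /= !S0; ring.
Qed.

Lemma continuous_dens2 (p : {poly R}) (z : R) : 0 < z -> {for z, continuous (dens2 p)}.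
Proof.
move=> z0; have zN0 : z != 0 by exact: lt0r_neq0.
have cinv : {for z, continuous (@GRing.inv R)} by exact: inv_continuous.
have cp : {for z, continuous (fun x : R => p.[x^-1])}.
  by apply: (continuous_comp cinv); exact: continuous_horner.
apply: cvgM.
  by rewrite expr2; apply: cvgM; exact: cp.
apply: cvgM.
  apply: (@continuous_comp _ _ _ (fun z : R => 4 * z - 1) Num.sqrt).
    by apply: cvgB; [apply: cvgM; [exact: cvg_cst|exact: cvg_id]|exact: cvg_cst].
  exact: sqrt_continuous.
apply: cvgV.
  by rewrite mulf_neq0 ?expf_neq0// mulf_neq0// gt_eqF// pi_gt0.
apply: cvgM; first exact: cvg_cst.
exact: exprn_continuous.
Qed.

Lemma cvgy_angle : angle z @[z --> +oo] --> pi / 2.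
Proof.
apply: (@cvg_comp _ _ _ (fun z => Num.sqrt (4 * z - 1)) atan _ +oo);
  last exact: cvgy_atan.
apply/cvgryPge => A; near=> z.
apply: le_trans (ler_norm _) _; rewrite -sqrtr_sqr; apply: ler_wsqrtr.
suff : A ^+ 2 + 1 <= z by have := sqr_ge0 A; lra.
by near: z; apply: nbhs_pinfty_ge; exact: num_real.
Unshelve. all: by end_near. Qed.

Lemma continuous_sin2_prim a b : continuous (sin2_prim a b).
Proof.
move=> x; apply/differentiable_continuous/derivable1_diffP.
by have [] := is_derive_sin2_prim a b x.
Qed.

(* Squares of sums are integrated instead of products because [ge0_continuous_FTC2y]
   asks for a nonnegative integrand; products follow by polarization. *)
Lemma integral_dens2_gpoly n m :
  (\int[lebesgue_measure]_(z in `[4^-1%R, +oo[) (dens2 (gpoly n + gpoly m) z)%:E =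
   (2 * (1 + (n == m)%:R))%:E)%E.
Proof.
pose P := sin2_prim (2 * n + 1)%:R (2 * m + 1)%:R.
(* The angle runs from 0 at z = 1/4 to pi / 2 at infinity, so the integral is the limit of [F] at
   infinity. *)
pose F : R -> R := cst (2 / pi) * (P \o angle).
have dF (z : R) : 4^-1 < z -> is_derive z 1 F (dens2 (gpoly n + gpoly m) z).
  move=> z4; have ? := is_derive_angle z4.
  have ? := is_derive_sin2_prim (2 * n + 1)%:R (2 * m + 1)%:R (angle z).
  apply: is_derive_eq; rewrite dens2E//.
  by rewrite /GRing.scale /= mulr0 addr0.
have F0 : F 4^-1 = 0.
  rewrite /F !fctE /= /angle (_ : 4 * 4^-1 - 1 = 0); last by field.
  by rewrite sqrtr0 atan0 /P sin2_prim0 mulr0.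
rewrite (@ge0_continuous_FTC2y _ (dens2 (gpoly n + gpoly m)) F 4^-1
  (2 * (1 + (n == m)%:R))).
- by rewrite F0 sube0.
- move=> z _; rewrite /dens2 mulr_ge0 ?density_ge0 ?sqr_ge0//.
- apply: continuous_in_subspaceT => z; rewrite inE/= in_itv /= andbT => z4.
  by apply: continuous_dens2; lra.
- have -> : 2 * (1 + (n == m)%:R) = 2 / pi * P (pi / 2) :> R.
    have : pi != 0 :> R by rewrite gt_eqF ?pi_gt0.
    by rewrite /P sin2_prim_pihalf; move: (pi : R) => q q0; field.
  apply: (@cvgM _ _ _ _ (cst (2 / pi)) (P \o angle)); first exact: cvg_cst.
  apply: (@cvg_comp _ _ _ angle P); first exact: cvgy_angle.
  exact: continuous_sin2_prim.
- by move=> z /dF [].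
- apply: cvg_at_right_filter.
  apply: (@cvgM _ _ _ _ (cst (2 / pi)) (P \o angle)); first exact: cvg_cst.
  apply: continuous_comp; first exact: continuous_angle.
  exact: continuous_sin2_prim.
- by move=> z; rewrite in_itv /= andbT => /dF [_ <-]; rewrite derive1E.
Qed.

End Orthonormality.

(** * Gram-Schmidt and spans *)

Section GramSchmidt.
Context {R : realType}.
Local Notation Z := (Z R).
Local Notation mu := (@mu R).
Implicit Types p q : {poly R}.

Lemma size_gpoly n : size (@gpoly R n) = n.+1.
Proof.
apply/eqP; rewrite eqn_leq; apply/andP; split.
  by apply/leq_sizeP => i lt_ni; rewrite coef_gpoly leqNgt lt_ni.
rewrite ltnNge; apply/negP => /leq_sizeP/(_ n (leqnn n))/eqP.
by rewrite coef_gpoly leqnn subnn bin0 mul1r oner_eq0.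
Qed.

(** As [gpoly n] is monic of degree n, subtracting a multiple of it removes the top coefficient. *)
Lemma gpoly_decomp n p : (size p <= n)%N ->
  exists a : nat -> R, p = \sum_(k < n) a k *: gpoly k.
Proof.
elim: n p => [|n IH] p.
  rewrite leqn0 size_poly_eq0 => /eqP ->.
  by exists (fun=> 0); rewrite big_ord0.
move=> sp; have [|a pE] := IH (p - p`_n *: gpoly n).
  apply/leq_sizeP => i; rewrite leq_eqVlt coefB coefZ => /predU1P[<-|lt_ni].
    by rewrite coef_gpoly leqnn subnn bin0 !mulr1 subrr.
  rewrite coef_gpoly leqNgt lt_ni mulr0 subr0.
  by apply/(leq_sizeP _ _ sp).
exists (fun k => if k == n then p`_n else a k).
rewrite big_ord_recr /= eqxx -[LHS](subrK (p`_n *: gpoly n)) pE; congr (_ + _).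
by apply: eq_bigr => k _; rewrite ltn_eqF.
Qed.

(** Both the powers z^{-n} and the g_{2n} have this form, which moves their algebra into the
    polynomial ring. *)
Definition pev p : Z -> R := fun z => p.[(Zval z)^-1].

Lemma zpowE n : @zpow R n = pev 'X^n.
Proof.
apply/funext => z; rewrite /zpow /pev hornerXn.
by rewrite exprVn exprnN.
Qed.

Lemma g_evenE n : @g_even R n = pev (gpoly n).
Proof.
apply/funext => z; rewrite /g_even /pev horner_sum; apply: eq_bigr => k _.
rewrite hornerZ hornerXn exprVn; congr (_ * _).
have le_kn : (k <= n)%N by rewrite -ltnS.
by rewrite -opprB subzn// exprnN.
Qed.

Lemma Zval_ge (z : Z) : 4^-1 <= Zval z.
Proof. by have := set_valP z; rewrite /Zset /= in_itv /= andbT. Qed.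

(** On [Z] one has 0 < 1/z <= 4. *)
Lemma pev_bound p : exists M : R, forall z, `|pev p z| <= M.
Proof.
exists (\sum_(i < size p) `|p`_i| * 4 ^+ i) => z.
rewrite /pev horner_coef; apply: le_trans (ler_norm_sum _ _ _) _.
apply: ler_sum => i _; rewrite normrM ler_wpM2l// normrX.
have z4 := Zval_ge z; have z0 : 0 < Zval z by lra.
rewrite lerXn2r ?nnegrE// ger0_norm ?invr_ge0 ?(ltW z0)//.
by rewrite invf_ple ?posrE.
Qed.

Lemma measurable_inv_horner p : measurable_fun setT (fun x : R => p.[x^-1]).
Proof.
apply: (measurableT_comp (f := horner p)); last exact: Defs.measurable_inv.
apply: continuous_measurable_fun => x; exact: continuous_horner.
Qed.

Lemma measurable_pev p : measurable_fun setT (pev p).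
Proof.
exact: (measurableT_comp (measurable_inv_horner p) (@measurable_Zval R)).
Qed.

Lemma integral_pev_sqr p :
  (\int[mu]_z (pev p z ^+ 2)%:E =
   \int[lebesgue_measure]_(x in `[4^-1%R, +oo[) (dens2 p x)%:E)%E.
Proof.
rewrite (@ge0_integral_mu R (fun x => p.[x^-1] ^+ 2))//.
- by apply: measurable_funX; exact: measurable_inv_horner.
- by move=> x; exact: sqr_ge0.
Qed.

(** The case n = m = 0 of [integral_dens2_gpoly] reads 4 mu(Z) = 4. Finiteness makes bounded
    measurable functions integrable. *)
Lemma mu_setT : mu setT = 1%E.
Proof.
have := integral_pev_sqr (gpoly 0 + gpoly 0).
rewrite integral_dens2_gpoly eqxx gpoly0 /pev.
under eq_integral do rewrite hornerD hornerC.
rewrite integral_cst//= => H.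
rewrite -[LHS]mul1e (_ : 1 = (4^-1)%:E * ((1 + 1) ^+ 2)%:E)%E; last first.
  by rewrite -EFinM; congr _%:E; field.
by rewrite -muleA H -EFinM; congr _%:E; field.
Qed.

Lemma integrable_pev p : mu.-integrable setT (EFin \o pev p).
Proof.
have mufin : (mu [set: Z] < +oo)%E by rewrite mu_setT ltry.
apply: measurable_bounded_integrable => //.
  exact: measurable_pev.
have [M pM] := pev_bound p.
exists M; split; first exact: num_real.
by move=> x Mx z _; rewrite /= (le_trans (pM z))// ltW.
Qed.

Definition pint p : R := \int[mu]_z pev p z.

Lemma pintD p q : pint (p + q) = pint p + pint q.
Proof.
rewrite -RintegralD//; [|exact: integrable_pev..].
by apply: eq_Rintegral => z _; rewrite /pev hornerD.
Qed.

Lemma pintZ a p : pint (a *: p) = a * pint p.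
Proof.
rewrite -RintegralZl//; last exact: integrable_pev.
by apply: eq_Rintegral => z _; rewrite /pev hornerZ.
Qed.

Lemma pint_sum (I : finType) (F : I -> {poly R}) :
  pint (\sum_i F i) = \sum_i pint (F i).
Proof.
apply: (big_morph pint pintD).
by rewrite -(scale0r 0) pintZ mul0r.
Qed.

Lemma inner_pev p q : inner (pev p) (pev q) = pint (p * q).
Proof. by apply: eq_Rintegral => z _; rewrite /pev hornerM. Qed.

(** The known integral of (g_n + g_m)^2 gives norm 1 when n = m; for distinct indices it equals 2 =
    1 + 1, so the cross term is zero. *)
Lemma pint_gpolyM n m : pint (gpoly n * gpoly m) = (n == m)%:R.
Proof.
have sqr k l : pint ((gpoly k + gpoly l) ^+ 2) = 2 * (1 + (k == l)%:R).
  rewrite /pint /Rintegral.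
  under eq_integral do rewrite /pev horner_exp.
  by rewrite integral_pev_sqr integral_dens2_gpoly.
have diag k : pint (gpoly k * gpoly k) = 1.
  have := sqr k k; rewrite eqxx mulr1n (_ : _ ^+ 2 = 4%:R *: (gpoly k * gpoly k)).
    by rewrite pintZ; lra.
  by rewrite scaler_nat; ring.
have [->|nm] := eqVneq n m; first by rewrite diag.
have := sqr n m; rewrite sqrrD !pintD (negPf nm) mulr0n !expr2 !diag.
by lra.
Qed.

(** Since 'X^n - [gpoly n] has degree below n, it is a combination of earlier [gpoly k]. By
    orthonormality its coefficients are the inner products that the Gram-Schmidt step subtracts. *)
Lemma gram_schmidt_zpow n : gram_schmidt (@zpow R) n = pev (gpoly n).
Proof.
elim/ltn_ind: n => n IH; apply/funext => z; rewrite gram_schmidtE.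
have [|a aE] := @gpoly_decomp n ('X^n - gpoly n).
  apply/leq_sizeP => i; rewrite leq_eqVlt coefB coefXn coef_gpoly => /predU1P[<-|lt_ni].
    by rewrite eqxx leqnn subnn bin0 mulr1 subrr.
  by rewrite gtn_eqF// leqNgt lt_ni subr0.
have XnE : 'X^n = gpoly n + \sum_(k < n) a k *: gpoly k.
  by rewrite -aE addrC subrK.
have inner_a (k : 'I_n) : pint ('X^n * gpoly k) = a k.
  rewrite XnE mulrDl pintD pint_gpolyM gtn_eqF// add0r mulr_suml pint_sum.
  rewrite (bigD1 k)//= big1 ?addr0 => [|j jk].
    by rewrite -scalerAl pintZ pint_gpolyM eqxx mulr1.
  move: jk; rewrite -val_eqE => /negPf jk.
  by rewrite -scalerAl pintZ pint_gpolyM jk mulr0.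
rewrite zpowE; transitivity (pev 'X^n z - \sum_(k < n) a k * pev (gpoly k) z).
  congr (_ - _); apply: eq_bigr => k _.
  by rewrite IH// !inner_pev inner_a pint_gpolyM eqxx divr1.
rewrite XnE /pev hornerD; apply/eqP; rewrite subr_eq; apply/eqP; congr (_ + _).
rewrite horner_sum; apply: eq_bigr => k _; exact: hornerZ.
Qed.

Lemma span_upto_pev (w : nat -> {poly R}) n :
  span_upto (fun k => pev (w k)) n =
  [set pev p | p in [set \sum_(k < n.+1) c k *: w k | c in [set: 'I_n.+1 -> R]]].
Proof.
have E c : (fun z => \sum_(k < n.+1) c k * pev (w k) z) =
    pev (\sum_(k < n.+1) c k *: w k).
  apply/funext => z; rewrite /pev horner_sum.
  by apply: eq_bigr => k _; rewrite hornerZ.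
apply/seteqP; split => [f [c ->]|_ [_ [c _ <-] <-]].
  by exists (\sum_(k < n.+1) c k *: w k) => //; exists c.
by exists c; rewrite E.
Qed.

(** Both sides consist of the polynomials of degree at most n. *)
Lemma span_gpoly_Xn n :
  [set \sum_(k < n.+1) c k *: 'X^k | c in [set: 'I_n.+1 -> R]] =
  [set \sum_(k < n.+1) c k *: gpoly k | c in [set: 'I_n.+1 -> R]].
Proof.
apply/seteqP; split => [_ [c _ <-]|_ [c _ <-]].
  have [|a ->] := @gpoly_decomp n.+1 (\sum_(k < n.+1) c k *: 'X^k).
    apply: (leq_trans (size_sum _ _ _)); apply/bigmax_leqP => k _.
    by rewrite (leq_trans (size_scale_leq _ _))// size_polyXn.
  by exists (fun k => a k).
set p := \sum_(k < _) _; exists (fun k => p`_k) => //.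
have sp : (size p <= n.+1)%N.
  apply: (leq_trans (size_sum _ _ _)); apply/bigmax_leqP => k _.
  by rewrite (leq_trans (size_scale_leq _ _))// size_gpoly.
by rewrite -poly_def; apply/polyP => i; rewrite coef_poly; case: ltnP => // ?;
  rewrite nth_default// (leq_trans sp).
Qed.

Lemma span_zpow n : span_upto (@zpow R) n = span_upto (@g_even R) n.
Proof.
rewrite (_ : @zpow R = fun k => pev 'X^k); last by apply/funext => k; exact: zpowE.
rewrite (_ : @g_even R = fun k => pev (gpoly k)); last by apply/funext => k; exact: g_evenE.
by rewrite !span_upto_pev span_gpoly_Xn.
Qed.

End GramSchmidt.

(** * Density of the polynomials in 1/z *)

Section StepPolynomials.
Context {R : realType}.
Implicit Types (q r u : R) (n : nat).

Lemma bernoulli_inequality u n : -1 <= u -> 1 + n%:R * u <= (1 + u) ^+ n.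
Proof.
move=> u1; elim: n => [|n IH]; first by rewrite mul0r addr0 expr0.
rewrite exprS; apply: le_trans (_ : (1 + u) * (1 + n%:R * u) <= _).
  rewrite -natr1; have : 0 <= n%:R * u ^+ 2 by rewrite mulr_ge0 ?sqr_ge0.
  by rewrite expr2; lra.
by rewrite ler_wpM2l//; lra.
Qed.

(** With r = s^2 and 1/s = 1 + h, Bernoulli bounds n s^n by 1/h, leaving a geometric factor s^n. *)
Lemma cvg_natr_mul_expr r : 0 <= r -> r < 1 -> n%:R * r ^+ n @[n --> \oo] --> (0 : R).
Proof.
rewrite le_eqVlt => /predU1P[<- _|r0 r1].
  rewrite (_ : (fun n => _) = cst 0); first exact: cvg_cst.
  by apply/funext => -[|n]; rewrite ?mul0r//= expr0n mulr0.
pose s := Num.sqrt r; have s0 : 0 < s by rewrite sqrtr_gt0.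
have rE : r = s ^+ 2 by rewrite sqr_sqrtr ?ltW.
have s1 : s < 1 by rewrite -(@ltr_pXn2r _ 2) ?nnegrE ?ltW// -rE expr1n.
pose h := s^-1 - 1; have h0 : 0 < h by rewrite subr_gt0 invf_gt1.
have sn n : n%:R * s ^+ n <= h^-1.
  have B : 1 + n%:R * h <= (s ^+ n)^-1.
    rewrite -exprVn (_ : s^-1 = 1 + h); last by rewrite /h; ring.
    by apply: bernoulli_inequality; lra.
  rewrite -[leRHS]div1r ler_pdivlMr// mulrAC.
  have : n%:R * h <= (s ^+ n)^-1 by lra.
  by rewrite -(@ler_pM2r _ (s ^+ n)) ?exprn_gt0// mulVf// gt_eqF// exprn_gt0.
apply: (@squeeze_cvgr _ _ _ _ (cst 0) (geometric h^-1 s)).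
- apply: nearW => n; have rn : r ^+ n = s ^+ n * s ^+ n.
    by rewrite rE -exprM mul2n -addnn exprD.
  have sn0 : 0 <= s ^+ n by rewrite exprn_ge0// ltW.
  by rewrite /= rn mulrA ler_wpM2r// !mulr_ge0.
- exact: cvg_cst.
- by apply: cvg_geometric; rewrite gtr0_norm.
Qed.

Lemma step_in01 q n m : 0 <= q -> q <= 1 -> 0 <= (1 - q ^+ n) ^+ m <= 1.
Proof.
move=> q0 q1; have qn1 : q ^+ n <= 1 by rewrite exprn_ile1.
have qn0 : 0 <= q ^+ n by rewrite exprn_ge0.
by rewrite exprn_ge0 ?exprn_ile1//; lra.
Qed.

(** Bernoulli gives the lower bound 1 - n 2^n q^n = 1 - n (2q)^n, where 2q < 1. *)
Lemma cvg_step1 q : 0 <= q -> q < 2^-1 ->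
  (1 - q ^+ n) ^+ (n * 2 ^ n) @[n --> \oo] --> (1 : R).
Proof.
move=> q0 q2; apply: (@squeeze_cvgr _ _ _ _ (fun n => 1 - n%:R * (2 * q) ^+ n) (cst 1)).
- apply: nearW => n; have /andP[_ ->] := @step_in01 q n (n * 2 ^ n) q0 ltac:(lra).
  rewrite andbT exprMn mulrA -natrX -natrM.
  have := @bernoulli_inequality (- q ^+ n) (n * 2 ^ n); rewrite mulrN; apply.
  by rewrite lerN2 exprn_ile1//; lra.
- rewrite -[X in _ --> X]subr0; apply: cvgB; first exact: cvg_cst.
  by apply: cvg_natr_mul_expr; lra.
- exact: cvg_cst.
Qed.

(* Without the factor [n] in the exponent the limit at [q = 1/2] would be [1/e]. *)
Lemma cvg_step0 q : 2^-1 <= q -> q <= 1 ->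
  (1 - q ^+ n) ^+ (n * 2 ^ n) @[n --> \oo] --> (0 : R).
Proof.
move=> q2 q1; have q0 : 0 <= q by lra.
apply: (@squeeze_cvgr _ _ _ _ (cst 0) harmonic); last exact: cvg_harmonic.
- apply: nearW => n; have /andP[-> _] := @step_in01 q n (n * 2 ^ n) q0 q1.
  set m := (n * 2 ^ n)%N; set u := q ^+ n => /=.
  have u0 : 0 <= u by rewrite exprn_ge0.
  have u1 : u <= 1 by rewrite exprn_ile1.
  (* Here m u = n (2q)^n with 2q >= 1. Then (1 + u)^m >= n + 1 by Bernoulli, and (1 - u)^m (1 + u)^m
     <= 1 yields the bound 1 / (n + 1). *)
  have mu_n : n%:R <= m%:R * u.
    rewrite natrM natrX -mulrA -exprMn ler_peMr// exprn_ege1//; lra.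
  have B : n.+1%:R <= (1 + u) ^+ m.
    by apply: le_trans (bernoulli_inequality _ _); rewrite -?natr1; lra.
  rewrite -[leRHS]div1r ler_pdivlMr//.
  apply: le_trans (_ : (1 - u) ^+ m * (1 + u) ^+ m <= _).
    by rewrite ler_wpM2l// exprn_ge0//; lra.
  rewrite -exprMn exprn_ile1//.
    by rewrite mulr_ge0//; lra.
  by have := sqr_ge0 u; rewrite expr2; lra.
- exact: cvg_cst.
Qed.

End StepPolynomials.

(** * The L^2 closure of the polynomials in 1/z *)

Section PolynomialApproximation.
Context {R : realType}.
Local Notation Z := (Z R).
Local Notation mu := (@mu R).
Implicit Types (f g h : Z -> R) (p q : {poly R}).

(** The squared L^2 distance, extended-valued so that it is meaningful without integrability. *)
Definition sqdist f g : \bar R := (\int[mu]_z ((f z - g z) ^+ 2)%:E)%E.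

Lemma sqdist_ge0 f g : (0 <= sqdist f g)%E.
Proof. by apply: integral_ge0 => z _; rewrite lee_fin sqr_ge0. Qed.

Lemma measurable_sqdiff f g : measurable_fun setT f -> measurable_fun setT g ->
  measurable_fun setT (fun z => ((f z - g z) ^+ 2)%:E).
Proof.
move=> mf mg; apply/measurable_EFinP; apply: measurable_funX.
exact: measurable_funB.
Qed.

Lemma sqdist_triangle f g h :
  measurable_fun setT f -> measurable_fun setT g -> measurable_fun setT h ->
  (sqdist f h <= 2%:E * sqdist f g + 2%:E * sqdist g h)%E.
Proof.
move=> mf mg mh.
have mfg := measurable_sqdiff mf mg.
have mgh := measurable_sqdiff mg mh.
have sq0 (u : R) : (0 <= (u ^+ 2)%:E)%E by rewrite lee_fin sqr_ge0.
rewrite -!ge0_integralZl// -ge0_integralD//=; first last.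
- exact: measurable_funeM.
- by move=> z _; rewrite mule_ge0.
- exact: measurable_funeM.
- by move=> z _; rewrite mule_ge0.
apply: ge0_le_integral => //.
- exact: measurable_sqdiff.
- by apply: emeasurable_funD; exact: measurable_funeM.
move=> z _; rewrite -!EFinM -EFinD lee_fin.
have := sqr_ge0 (f z - g z - (g z - h z)); rewrite !expr2; lra.
Qed.

(** Membership in the L^2 closure of the polynomials in 1/z; measurability is carried along for
    [sqdist_triangle]. *)
Definition poly_approx f := measurable_fun setT f /\
  forall e : R, 0 < e -> exists p, (sqdist f (pev p) < e%:E)%E.

Lemma poly_approx_closed f : measurable_fun setT f ->
  (forall e : R, 0 < e -> exists2 g, poly_approx g & (sqdist f g < e%:E)%E) ->
  poly_approx f.
Proof.
(* A quarter of [e] for each of two terms absorbs the factor 2 of [sqdist_triangle]. *)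
move=> mf fg; split=> // e e0; have e4 : 0 < e / 4 by lra.
have [g [mg gp] fge] := fg _ e4; have [p gpe] := gp _ e4.
exists p; apply: le_lt_trans (sqdist_triangle mf mg (measurable_pev p)) _.
rewrite (_ : e%:E = 2%:E * (e / 4)%:E + 2%:E * (e / 4)%:E)%E; last first.
  by rewrite -!EFinM -EFinD; congr _%:E; field.
by rewrite lteD// lte_pmul2l.
Qed.

Lemma poly_approx_pev p : poly_approx (pev p).
Proof.
split; first exact: measurable_pev.
move=> e e0; exists p; rewrite /sqdist integral0_eq// => z _.
by rewrite subrr expr0n.
Qed.

Lemma poly_approxD f g : poly_approx f -> poly_approx g ->
  poly_approx (fun z => f z + g z).
Proof.
move=> [mf fp] [mg gp].
have mD (k l : Z -> R) : measurable_fun setT k -> measurable_fun setT l ->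
    measurable_fun setT (fun z => k z + l z) by exact: measurable_funD.
split=> [|e e0]; first exact: mD.
have e4 : 0 < e / 4 by lra.
have [p fpe] := fp _ e4; have [q gqe] := gp _ e4.
have mp := measurable_pev p; have mq := measurable_pev q.
exists (p + q).
(* Through the intermediate point [pev p] + [g], one summand is replaced at a time. *)
apply: le_lt_trans (sqdist_triangle (mD _ _ mf mg) (mD _ _ mp mg) (measurable_pev _)) _.
have -> : sqdist (fun z => f z + g z) (fun z => pev p z + g z) = sqdist f (pev p).
  by apply: eq_integral => z _; congr (_ ^+ 2)%:E; ring.
have -> : sqdist (fun z => pev p z + g z) (pev (p + q)) = sqdist g (pev q).
  by apply: eq_integral => z _; congr (_ ^+ 2)%:E; rewrite /pev hornerD; ring.
rewrite (_ : e%:E = 2%:E * (e / 4)%:E + 2%:E * (e / 4)%:E)%E; last first.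
  by rewrite -!EFinM -EFinD; congr _%:E; field.
by rewrite lteD// lte_pmul2l.
Qed.

Lemma poly_approxZ a f : poly_approx f -> poly_approx (fun z => a * f z).
Proof.
move=> [mf fp]; split=> [|e e0]; first exact: measurable_funM.
(* Adding 1 keeps the divisor positive when a = 0. *)
have a0 : 0 < a ^+ 2 + 1 by have := sqr_ge0 a; lra.
have [p fpe] := fp (e / (a ^+ 2 + 1)) (divr_gt0 e0 a0).
exists (a *: p).
have -> : (sqdist (fun z => a * f z)%R (pev (a *: p)) = (a ^+ 2)%:E * sqdist f (pev p))%E.
  rewrite -ge0_integralZl//.
  - by apply: eq_integral => z _; rewrite -EFinM /pev hornerZ -mulrBr exprMn.
  - exact: measurable_sqdiff (measurable_pev p).
  - by move=> z _; rewrite lee_fin sqr_ge0.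
  - by rewrite lee_fin sqr_ge0.
apply: (@le_lt_trans _ _ ((a ^+ 2 + 1)%R%:E * sqdist f (pev p))%E).
  by apply: lee_wpmul2r; rewrite ?sqdist_ge0// lee_fin lerDl.
rewrite (_ : e%:E = (a ^+ 2 + 1)%:E * (e / (a ^+ 2 + 1))%:E)%E; last first.
  by rewrite -EFinM mulrC divfK// gt_eqF.
by rewrite lte_pmul2l.
Qed.

Lemma poly_approx_sum (I : Type) (s : seq I) (F : I -> Z -> R) :
  (forall i, poly_approx (F i)) -> poly_approx (fun z => \sum_(i <- s) F i z).
Proof.
move=> HF; elim: s => [|i s IH].
  have := poly_approx_pev 0; congr poly_approx; apply/funext => z.
  by rewrite big_nil /pev horner0.
have := poly_approxD (HF i) IH; congr poly_approx; apply/funext => z.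
by rewrite big_cons.
Qed.

(** Dominated convergence for the squares (f - f_n)^2 shows that f_n tends to f in L^2; the closure
    then contains f. *)
Lemma poly_approx_dominated (f_ : (Z -> R)^nat) f g :
  measurable_fun setT f -> (forall n, poly_approx (f_ n)) ->
  (forall z, f_ n z @[n --> \oo] --> f z) ->
  mu.-integrable setT (fun z => (g z ^+ 2)%:E) ->
  (forall n z, `|f z - f_ n z| <= g z) -> poly_approx f.
Proof.
move=> mf af_ f_f ig fg.
have mf_ n : measurable_fun setT (f_ n) by case: (af_ n).
have cv : {ae mu, forall z, setT z ->
    ((f z - f_ n z) ^+ 2)%:E @[n --> \oo] --> (cst 0%E z : \bar R)}.
  apply: aeW => z _; apply: cvg_EFin; first exact: nearW.
  rewrite (_ : _ \o _ = (fun n => (f z - f_ n z) * (f z - f_ n z))); last first.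
    by apply/funext => n /=; rewrite expr2.
  have H : f z - f_ n z @[n --> \oo] --> (0 : R).
    by rewrite -(subrr (f z)); apply: cvgB => //; exact: cvg_cst.
  by rewrite -[X in _ --> X](mulr0 0); exact: cvgM.
have dom : {ae mu, forall z n, setT z ->
    (`|((f z - f_ n z) ^+ 2)%R%:E| <= (g z ^+ 2)%R%:E)%E}.
  apply: aeW => z n _; rewrite abse_EFin lee_fin ger0_norm ?sqr_ge0//.
  rewrite -real_normK ?num_real// lerXn2r ?nnegrE ?fg//.
  exact: le_trans (fg n z).
have [_ _] := @dominated_convergence _ _ R mu setT measurableT _ _ _
  (fun n => measurable_sqdiff mf (mf_ n)) (measurable_cst _) cv ig dom.
rewrite integral0 => sq0; apply: poly_approx_closed => // e e0.
have := sq0 _ (open_ereal_lt' (_ : 0 < e%:E)%E); rewrite lte_fin => /(_ e0)[n _ H].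
by exists (f_ n) => //; exact: (H n (leqnn n)).
Qed.

End PolynomialApproximation.

(** * From indicators of rays to all of L^2 *)

Section Density.
Context {R : realType}.
Local Notation Z := (Z R).
Local Notation mu := (@mu R).
Local Notation leb := (leb R).

Lemma integrable_cst1 : mu.-integrable setT (fun z : Z => (1 ^+ 2 : R)%:E).
Proof.
have := @integrable_pev R 1; congr (_.-integrable _ _); apply/funext => z /=.
by rewrite /pev hornerC expr1n.
Qed.

(** The affine function is q = 1/2 + (x - a) / 8: it lies in [0, 1] for x and a in ]0, 4], and q <
    1/2 exactly when x < a. *)
Definition step_poly (a : R) n : {poly R} :=
  (1 - (8^-1 *: 'X + (2^-1 - a / 8)%:P) ^+ n) ^+ (n * 2 ^ n).

Lemma step_polyE a n z : pev (step_poly a n) z =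
  (1 - (2^-1 + ((Zval z)^-1 - a) / 8) ^+ n) ^+ (n * 2 ^ n).
Proof.
rewrite /pev /step_poly horner_exp hornerD hornerN horner_exp hornerC.
rewrite hornerD hornerZ hornerX hornerC; congr ((1 - _ ^+ _) ^+ _).
by move: (Zval z)^-1 => x; field.
Qed.

Lemma poly_approx_ray (b : R) :
  poly_approx (\1_((@Zval R : Z -> R) @^-1` `]b, +oo[) : Z -> R).
Proof.
(* For b < 1/4 the ray contains all of [Z]; otherwise z > b means 1/z < a with a = 1/b <= 4. *)
have [b4|b4] := ltP b 4^-1.
  have := @poly_approx_pev R 1; congr poly_approx; apply/funext => z.
  rewrite /pev hornerC indicE mem_set//= in_itv /= andbT.
  exact: lt_le_trans b4 (Zval_ge z).
have b0 : 0 < b by lra.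
pose a := b^-1; have a4 : a <= 4 by rewrite invf_ple ?posrE.
have a0 : 0 < a by rewrite invr_gt0.
have rangeZ (z : Z) : 0 < (Zval z)^-1 <= 4.
  have z4 := Zval_ge z; have z0 : 0 < Zval z by lra.
  by rewrite invr_gt0 z0 invf_ple ?posrE.
apply: (@poly_approx_dominated R (fun n => pev (step_poly a n)) _ (cst 1)).
- apply: measurable_indic; rewrite -[_ @^-1` _]setTI.
  by apply: measurable_Zval => //; exact: measurable_itv.
- by move=> n; exact: poly_approx_pev.
- move=> z; under eq_fun do rewrite step_polyE.
  have /andP[x0 x4] := rangeZ z; rewrite indicE.
  have bz : (b < Zval z) = ((Zval z)^-1 < a).
    by rewrite /a ltf_pV2// posrE; have := Zval_ge z; lra.
  case: (boolP (b < Zval z)) => [zb|zb].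
    rewrite mem_set; last by rewrite /= in_itv /= zb.
    by move: zb; rewrite bz => zb; apply: cvg_step1; lra.
  rewrite memNset; last by rewrite /= in_itv /= andbT; exact/negP.
  by move: zb; rewrite bz -leNgt => zb; apply: cvg_step0; lra.
- exact: integrable_cst1.
- move=> n z; have /andP[x0 x4] := rangeZ z; rewrite step_polyE /=.
  have /andP[] := @step_in01 R (2^-1 + ((Zval z)^-1 - a) / 8) n (n * 2 ^ n)
    ltac:(lra) ltac:(lra).
  by rewrite indicE ler_norml; case: (_ \in _) => /=; lra.
Qed.

(** Rays form a pi-system generating the Borel sets. Complements come from 1 minus an indicator,
    disjoint unions from partial sums within 1 of their limit. *)
Lemma poly_approx_borel (B : set (measurableTypeR R)) : measurable B ->
  poly_approx (\1_((@Zval R : Z -> R) @^-1` B) : Z -> R).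
Proof.
have mpre (A : set (measurableTypeR R)) : measurable A ->
    measurable ((@Zval R : Z -> R) @^-1` A).
  by move=> mA; rewrite -[_ @^-1` _]setTI; exact: measurable_Zval.
have GE : @measurable _ (measurableTypeR R) = <<s @RGenOInfty.G R >>.
  exact: RGenOInfty.measurableE.
move=> mB; have sB : <<s @RGenOInfty.G R >> B by rewrite -GE.
move: B sB {mB}; apply: (@dynkin_induction _ (measurableTypeR R) _ _ GE).
- move=> _ _ [x ->] [y ->]; exists (Num.max x y).
  rewrite predeqE => u; rewrite /= !in_itv /= !andbT gt_max.
  by split => [[xu yu]|/andP[]//]; apply/andP.
- have := @poly_approx_pev R 1; congr poly_approx; apply/funext => z.
  by rewrite /pev hornerC indicE mem_set.
- by move=> _ [x ->]; exact: poly_approx_ray.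
- move=> S mS aS; have := poly_approxD (@poly_approx_pev R 1) (poly_approxZ (-1) aS).
  congr poly_approx; apply/funext => z; rewrite /pev hornerC !indicE preimage_setC in_setC.
  by case: (_ \in _) => /=; lra.
- move=> F mF tF aF.
  pose FZ n := (@Zval R : Z -> R) @^-1` F n.
  have tFZ : trivIset setT FZ.
    by move=> i j _ _ [z [Fi Fj]]; apply: tF => //; exists (Zval z).
  rewrite preimage_bigcup -/(FZ _).
  have cF z : (\sum_(0 <= i < n) \1_(FZ i) z : R) @[n --> \oo] --> (\1_(\bigcup_n FZ n) z : R).
    have : (fun n => (\sum_(0 <= i < n) (\1_(FZ i) z)%:E)%E) @ \oo -->
        ((\1_(\bigcup_n FZ n) z)%:E : \bar R).
      by rewrite indic_bigcup//; apply: is_cvg_nneseries => n _ _; rewrite lee_fin.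
    by move/fine_cvg; under eq_fun do rewrite /= sumEFin.
  apply: (@poly_approx_dominated R (fun n z => \sum_(0 <= i < n) \1_(FZ i) z) _ (cst 1)) => //.
  + by apply: measurable_indic; apply: bigcup_measurable => n _; exact: mpre.
  + by move=> n; apply: poly_approx_sum.
  + exact: integrable_cst1.
  + move=> n z; have : \sum_(0 <= i < n) \1_(FZ i) z <= \1_(\bigcup_n FZ n) z :> R.
      rewrite -lee_fin indic_bigcup// -sumEFin.
      by apply: nneseries_lim_ge => i _ _; rewrite lee_fin.
    have : 0 <= \sum_(0 <= i < n) \1_(FZ i) z :> R by apply: sumr_ge0.
    have : \1_(\bigcup_n FZ n) z <= 1 :> R by rewrite indicE; case: (_ \in _).
    by rewrite /= ler_norml; lra.
Qed.

(** The squared difference of the indicators is at most that of [N], whose integral is zero. *)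
Lemma poly_approx_null (E F N : set Z) : measurable F -> measurable N ->
  mu N = 0%E -> (forall z, ~ N z -> E z <-> F z) ->
  poly_approx (\1_E : Z -> R) -> poly_approx (\1_F : Z -> R).
Proof.
move=> mF mN muN EF aE; apply: poly_approx_closed; first exact: measurable_indic.
move=> e e0; exists (\1_E) => //; apply: (@le_lt_trans _ _ 0%E); last by rewrite lte_fin.
rewrite -muN -[X in mu X]setIT -integral_indic//.
apply: ge0_le_integral => //.
- by move=> z _; rewrite lee_fin sqr_ge0.
- by apply: measurable_sqdiff; [exact: measurable_indic|case: aE].
- exact/measurable_EFinP/measurable_indic.
move=> z _; rewrite lee_fin !indicE.
have [Nz|Nz] := pselect (N z).
  by rewrite (mem_set Nz); case: (_ \in _); case: (_ \in _); rewrite expr2 /=; lra.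
have -> : (z \in F) = (z \in E) by apply/idP/idP; rewrite !inE => /EF; exact.
by rewrite subrr expr0n.
Qed.

Lemma poly_approx_indic (E : set Z) : measurable E -> poly_approx (\1_E : Z -> R).
Proof.
move=> mE; case: (mE) => L mL; rewrite setTI => LE.
(* A Lebesgue measurable set is a Borel set [A] joined with a subset [N] of a Borel null set [F];
   the preimage of [F] is null for [mu], which has a density. *)
have : (completed_algebra_gen (@lebesgue_measure R)) L.
  rewrite -g_sigma_completed_algebra_genE completed_caratheodory_measurable.
  exact: mL.
case=> A mA [N [F [mF F0 NF]] ANL].
apply: (@poly_approx_null (@Zval R @^-1` A) _ (@Zval R @^-1` F)) => //.
- by exists F; [exact: sub_leb|rewrite setTI].
- rewrite /mu image_Zval_preimage.
  have mFZ : measurable (F `&` @Zset R : set leb).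
    by apply: measurableI; apply: sub_leb => //; exact: measurable_itv.
  apply: null_set_integral => //.
    apply/measurable_EFinP; apply: measurable_funTS; exact: measurable_density.
  apply: (@subset_measure0 _ leb R completed_lebesgue_measure _ F) => //.
  exact: sub_leb.
- move=> z NFz; rewrite -LE -ANL /=; split => [Az|[//|/NF]]; [by left|].
  by [].
- exact: poly_approx_borel.
Qed.

Import HBNNSimple.

Lemma poly_approx_nnsfun (h : {nnsfun Z >-> R}) : poly_approx h.
Proof.
rewrite [X in poly_approx X](funext (fimfunEord h)).
by apply: poly_approx_sum => i; apply: poly_approxZ; exact: poly_approx_indic.
Qed.

(** Simple functions increasing to [f] differ from it by at most [f], whose square is integrable. *)
Lemma poly_approx_ge0 (f : Z -> R) : measurable_fun setT f -> (forall z, 0 <= f z) ->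
  mu.-integrable setT (fun z => (f z ^+ 2)%:E) -> poly_approx f.
Proof.
move=> mf f0 if2; have mEf : measurable_fun setT (EFin \o f) by exact/measurable_EFinP.
have Ef0 z : setT z -> (0 <= (EFin \o f) z)%E by rewrite /= lee_fin.
pose h := nnsfun_approx measurableT mEf.
have hf n z : h n z <= f z.
  by rewrite -lee_fin /h nnsfun_approxE; exact: le_approx.
apply: (poly_approx_dominated (f_ := fun n => h n) mf _ _ if2).
- by move=> n; exact: poly_approx_nnsfun.
- move=> z; apply: (@fine_cvg _ _ _ _ (fun n => (h n z)%:E) (f z)).
  exact: (cvg_nnsfun_approx _ mEf Ef0).
- move=> n z; rewrite ger0_norm ?subr_ge0//.
  by rewrite lerBlDr lerDl.
Qed.

(** Positive and negative parts are bounded by the absolute value of [f], hence square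
    integrable. *)
Lemma poly_approx_L2 (f : Z -> R) : L2 f -> poly_approx f.
Proof.
move=> L2f; have if2 := Lfun2_integrable_sqr L2f.
have mf : measurable_fun setT f.
  by move: L2f; rewrite /L2 /= inE => /andP[/[!inE]].
have ig2 (g : Z -> R) : measurable_fun setT g -> (forall z, `|g z| <= `|f z|) ->
    mu.-integrable setT (fun z => (g z ^+ 2)%:E).
  move=> mg gf; apply: le_integrable if2 => //.
    by apply/measurable_EFinP; exact: measurable_funX.
  move=> z _; rewrite /= lee_fin !normrX lerXn2r ?nnegrE//.
have part_ge0 (g : Z -> R) : measurable_fun setT g -> (forall z, `|g z| <= `|f z|) ->
    poly_approx (fun z => Num.max (g z) 0).
  move=> mg gf; have mm : measurable_fun setT (fun z => Num.max (g z) 0).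
    exact: measurable_funrpos mg.
  apply: poly_approx_ge0 => //; first by move=> z; rewrite le_max lexx orbT.
  apply: ig2 => // z; apply: le_trans (gf z).
  by case: (leP (g z) 0) => // _; rewrite normr0.
have := poly_approxD (part_ge0 _ mf (fun z => lexx _))
  (poly_approxZ (-1) (part_ge0 (fun z => - f z) _ _)).
move=> H; rewrite (_ : f = fun z => Num.max (f z) 0 + -1 * Num.max (- f z) 0).
  apply: H; first exact: measurableT_comp.
  by move=> z; rewrite normrN.
apply/funext => z; case: (leP (f z) 0); case: (leP (- f z) 0); lra.
Qed.

End Density.

(** * The powers of 1/z as a basis *)

Section Basis.
Context {R : realType}.

Lemma L2_pev (p : {poly R}) : L2 (pev p).
Proof.
rewrite /L2 /= inE; apply/andP; split; rewrite inE /=; first exact: measurable_pev.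
rewrite /finite_norm unlock poweR_lty//.
have E z : (`|(EFin \o pev p) z| `^ 2 = (pev p z ^+ 2)%:E)%E.
  by rewrite /= powR_mulrn// real_normK ?num_real.
under eq_integral do rewrite E.
apply: integrable_lty => //.
have := integrable_pev (p ^+ 2); congr (_.-integrable _ _).
by apply/funext => z; rewrite /= /pev horner_exp.
Qed.

Lemma L2_basis_zpow : L2_basis [set @zpow R n | n in [set: nat]].
Proof.
split=> [_ [n _ <-]|f L2f e e0]; first by rewrite zpowE; exact: L2_pev.
have [mf fp] := poly_approx_L2 L2f.
have [p fpe] := fp (e ^+ 2) (exprn_gt0 2 e0).
(* The sum has [size p] + 1 terms, the last coefficient being 0; this also covers p = 0. *)
exists (size p), (fun k => @zpow R k), (fun k => p`_k); split => [k|]; first by exists k.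
rewrite (_ : (fun z => _) = fun z => f z - pev p z); last first.
  apply/funext => z; congr (_ - _); rewrite /pev (horner_coef_wide _ (leqnSn _)).
  by apply: eq_bigr => k _; rewrite zpowE /pev hornerXn.
rewrite -[ltRHS](ger0_norm (ltW e0)) -sqrtr_sqr ltr_sqrt ?exprn_gt0//.
(* The real integral in [norm2] agrees with [sqdist], which is finite because it is below e^2. *)
rewrite -lte_fin /inner /Rintegral fineK; first exact: fpe.
rewrite ge0_fin_numE; first exact: lt_trans fpe (ltry _).
exact: sqdist_ge0.
Qed.

End Basis.

Theorem theorem20 (R : realType) :
  [/\ L2_basis [set @zpow R n | n in [set: nat]],
      forall n : nat, gram_schmidt (@zpow R) n = @g_even R n
    & forall n : nat, span_upto (@zpow R) n = span_upto (@g_even R) n].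
Proof.
split=> [|n|n].
- exact: L2_basis_zpow.
- by rewrite gram_schmidt_zpow g_evenE.
- exact: span_zpow.
Qed.
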